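(* Let $N$ be a positive integer with positive divisors $q_1,\dots,q_K$. For every decimation ratio $p$ (that is, for every factorization $N=pd$ with $p,d$ positive integers), the filter bank based on the Ramanujan sums $c_{q_1},c_{q_2},\dots,c_{q_K}$ with decimation ratio $p$ is not robust to one filter bank erasure.
   Context: $\ell^2(\mathbb Z_N)$ is the $N$-dimensional complex Hilbert space of functions on $\mathbb Z_N=\{0,1,\dots,N-1\}$ (identified with $N$-periodic functions on $\mathbb Z$), with $\langle x,y\rangle=\sum_{n=0}^{N-1}x(n)\overline{y(n)}$. For $m\in\mathbb Z$, the circular shift is $L_mx(n)=x(n-m)$. For a positive integer $q$, the $q$-th Ramanujan sum is $c_q(n)=\sum_{1\le k\le q,\,(k,q)=1}e^{2\pi i kn/q}$; it is $q$-periodic, so for $q\mid N$ it is regarded as an element of $\ell^2(\mathbb Z_N)$. A finite family $(f_j)$ in a finite-dimensional Hilbert space $H$ is a frame for $H$ if there are constants $A,B>0$ with $A\|x\|^2\le\sum_j|\langle x,f_j\rangle|^2\le B\|x\|^2$ for all $x\in H$. The filter bank based on $c_{q_1},\dots,c_{q_K}$ with decimation ratio $p$ (where $N=pd$) has associated system $\{L_{pk}c_{q_i}: 0\le k\le d-1,\ 1\le i\le K\}$. It is robust to one filter bank erasure if, for every $j\in\{1,\dots,K\}$, the system $\{L_{pk}c_{q_i}:0\le k\le d-1,\ 1\le i\le K,\ i\ne j\}$ obtained by removing the $j$-th channel is a frame for $\ell^2(\mathbb Z_N)$. *)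

(* Defs.v *)
From mathcomp Require Import all_boot all_order all_algebra.
From mathcomp Require Import spectral.
From mathcomp Require Import reals trigo.
From mathcomp Require Import complex.

Set Implicit Arguments.
Unset Strict Implicit.
Unset Printing Implicit Defensive.

Import Order.TTheory GRing.Theory Num.Theory.

Local Open Scope ring_scope.
Local Open Scope complex_scope.

Section RamanujanFilterBank.

Variable R : realType.

(* The Hilbert space l^2(Z_N).  The index type is 'I_N and not 'Z_N, because
   'Z_1 has two elements.  Its inner product is [dotmx], see [ell2_dotE]. *)
Definition ell2 (N : nat) : Type := 'rV[R[i]]_N.

Lemma ell2_dotE (N : nat) (x y : ell2 N) :
  dotmx x y = \sum_(n < N) x 0 n * (y 0 n)^*%C.
Proof. by rewrite dotmxE !mxE; apply: eq_bigr => n _; rewrite !mxE. Qed.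

(* n - m reduced modulo N.  The default value n of [insubd] is never used:
   N > 0 as 'I_N is inhabited, so the remainder lies in {0, ..., N - 1}. *)
Definition subZN (N : nat) (n : 'I_N) (m : int) : 'I_N :=
  insubd n `|((n%:Z - m) %% N%:Z)%Z|%N.

Lemma subZNE (N : nat) (n : 'I_N) (m : int) :
  (subZN n m : nat)%:Z = ((n%:Z - m) %% N%:Z)%Z.
Proof.
have N_gt0 : (0 < N)%N by apply: leq_ltn_trans (ltn_ord n).
have N_neq0 : N%:Z != 0 by rewrite eqz_nat -lt0n.
have r_ge0 := modz_ge0 (n%:Z - m) N_neq0.
rewrite /subZN val_insubd ifT ?gez0_abs //.
by rewrite -ltz_nat gez0_abs // ltz_pmod.
Qed.

(* The circular shift L_m. *)
Definition circ_shift (N : nat) (m : int) (x : ell2 N) : ell2 N :=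
  \row_(n < N) x 0 (subZN n m).

Definition expi (t : R) : R[i] := cos t +i* sin t.

Definition ramanujan_sum (q : nat) (n : int) : R[i] :=
  \sum_(1 <= k < q.+1 | coprime k q) expi (2 * pi * k%:R * n%:~R / q%:R).

(* The Ramanujan sum as an element of l^2(Z_N); meaningful when q divides N. *)
Definition ramanujan (N q : nat) : ell2 N :=
  \row_(n < N) ramanujan_sum q n%:Z.

(* The bounds are stated in R[i], where <= holds only between numbers with the
   same imaginary part; both sides here are real. *)
Definition is_frame (N : nat) (J : finType) (f : J -> ell2 N) : Prop :=
  exists A B : R, [/\ 0 < A, 0 < B &
    forall x : ell2 N,
      A%:C * dotmx x x <= \sum_(j : J) `|dotmx x (f j)| ^+ 2
                       <= B%:C * dotmx x x].

Definition ramanujan_filter_bank (N p d : nat) (I : finType) (q : I -> nat)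
    (ki : 'I_d * I) : ell2 N :=
  circ_shift (p * ki.1)%:Z (ramanujan N (q ki.2)).

Definition robust_one_erasure (N p d K : nat) (q : 'I_K -> nat) : Prop :=
  forall j : 'I_K,
    is_frame (@ramanujan_filter_bank N p d {i : 'I_K | i != j} (q \o val)).

End RamanujanFilterBank.

(* Main.v *)
(** The character n |-> zeta^n with zeta = exp(2 pi i / q_j) takes part only in
    the sum c_(q_j): every c_q is a sum of characters n |-> v^n with v a
    primitive q-th root of unity, shifts act on these by scalars, and distinct
    characters of Z_N are orthogonal.  Erasing the j-th channel therefore leaves
    a system orthogonal to a nonzero vector, whatever the decimation ratio. *)
Require Import Defs.
From mathcomp Require Import all_boot all_order all_algebra.
From mathcomp Require Import reals.
From mathcomp Require Import spectral trigo complex.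
From mathcomp Require Import ring lra.

Import Order.TTheory GRing.Theory Num.Theory.

Local Open Scope ring_scope.
Local Open Scope complex_scope.

Lemma prim_root_inj_order (F : nzRingType) (m n : nat) (z : F) :
  m.-primitive_root z -> n.-primitive_root z -> m = n.
Proof.
move=> zm zn; apply/eqP; rewrite eqn_dvd.
by rewrite (prim_order_dvd zm) (prim_order_dvd zn) !prim_expr_order ?eqxx.
Qed.

(** Geometric series: [w - 1] times the sum is [w ^+ N - 1 = 0], and a field has no zero
    divisors. *)
Lemma sum_unity_root (F : fieldType) (N : nat) (w : F) :
  w ^+ N = 1 -> w != 1 -> \sum_(n < N) w ^+ n = 0.
Proof.
move=> wN w1; have := subrX1 w N; rewrite wN subrr => /esym/eqP.
by rewrite mulf_eq0 subr_eq0 (negPf w1) => /eqP.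
Qed.

Section RootsOfUnity.
Variable R : realType.
Implicit Types t s : R.

Lemma expi0 : expi 0 = 1 :> R[i].
Proof. by rewrite /expi cos0 sin0. Qed.

Lemma expiD t s : expi (t + s) = expi t * expi s.
Proof.
by rewrite /expi cosD sinD; congr (_ +i* _); ring.
Qed.

Lemma expiMn t n : expi (t *+ n) = expi t ^+ n.
Proof.
by elim: n => [|n IHn]; rewrite ?mulr0n ?expi0 // mulrS exprS expiD IHn.
Qed.

Lemma conjc_expi t : (expi t)^*%C = expi (- t).
Proof. by rewrite /expi cosN sinN. Qed.

Lemma expi_neq0 t : expi t != 0.
Proof.
apply/eqP => t0; have := expiD t (- t); rewrite subrr expi0 t0 mul0r => /eqP.
by rewrite oner_eq0.
Qed.

Lemma conjc_expiV t : (expi t)^*%C = (expi t)^-1.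
Proof.
apply: (mulfI (expi_neq0 t)).
by rewrite conjc_expi -expiD subrr expi0 divff ?expi_neq0.
Qed.

Lemma expi_2pi : expi (2 * pi) = 1 :> R[i].
Proof. by rewrite /expi mulr_natl cos2pi sin2pi. Qed.

(** The real part already differs: [cos t = 1 - 2 * sin (t / 2) ^+ 2], and [t / 2] lies in the open
    interval from 0 to [pi], where the sine is positive. *)
Lemma expi_neq1 t : 0 < t < 2 * pi -> expi t != 1.
Proof.
move=> /andP[t_gt0 t_lt]; have s_gt0 : 0 < sin (t / 2).
  by apply: sin_gt0_pi; rewrite divr_gt0 ?ltr_pdivrMr // mulrC.
rewrite eq_complex negb_and /=; apply/orP; left.
have -> : t = (t / 2) *+ 2 by rewrite -mulr_natr divfK ?pnatr_eq0.
rewrite cos_mulr2n cos2sin2; apply/eqP.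
have : 0 < sin (t / 2) ^+ 2 by rewrite exprn_gt0.
lra.
Qed.

Definition zeta (q : nat) : R[i] := expi (2 * pi / q%:R).

Lemma zeta_primitive (q : nat) : (0 < q)%N -> q.-primitive_root (zeta q).
Proof.
move=> q_gt0; have qR0 : 0 < q%:R :> R by rewrite ltr0n.
have piR := pi_gt0 R.
(* The exponents tested are [i.+1] with [i < q], that is 1 to [q]. The last gives the angle
   [2 * pi], the others an angle strictly between 0 and [2 * pi]. *)
apply/andP; split=> //; apply/forallP => i; rewrite unity_rootE -expiMn.
have [iq|iq] := eqVneq i.+1 q.
  by rewrite iq -[_ / _ *+ _]mulr_natr divfK ?(gt_eqF qR0) // expi_2pi !eqxx.
apply/eqP/negbTE/expi_neq1; rewrite -[_ / _ *+ _]mulr_natr mulrAC.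
apply/andP; split.
  by rewrite divr_gt0 // !mulr_gt0.
rewrite ltr_pdivrMr // ltr_pM2l ?mulr_gt0 // ltr_nat.
by rewrite ltn_neqAle iq ltn_ord.
Qed.

Lemma conjc_zeta (q : nat) : (zeta q)^*%C = (zeta q)^-1.
Proof. exact: conjc_expiV. Qed.

Lemma zeta_neq0 (q : nat) : zeta q != 0.
Proof. exact: expi_neq0. Qed.

Lemma ramanujan_sum_nat (q n : nat) :
  ramanujan_sum R q n%:Z
  = \sum_(1 <= k < q.+1 | coprime k q) (zeta q ^+ k) ^+ n.
Proof.
apply: eq_bigr => k _; rewrite -exprM -expiMn; congr expi.
by rewrite -[RHS]mulr_natr natrM -pmulrn; ring.
Qed.

(** A character of Z_N exactly when [u ^+ N = 1], which the lemmas below assume where they need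
    it. *)
Definition char_vec (N : nat) (u : R[i]) : ell2 R N := \row_(n < N) u ^+ n.

(** Powers of [v] depend only on the exponent modulo [N], and [subZN n m + m] is congruent to [n].
    This is how a shift acts on a character by the scalar [v ^- m]. *)
Lemma expr_subZN (N m : nat) (v : R[i]) (n : 'I_N) :
  v ^+ N = 1 -> v != 0 -> v ^+ subZN n m = v ^+ n / v ^+ m.
Proof.
move=> vN v0; apply: (canRL (mulfK _)); first by rewrite expf_neq0.
have := subZNE n m; set s : nat := subZN n m => sE.
have /eqP snm : (s + m == n %[mod N])%N.
  by rewrite -eqz_nat -!modz_nat PoszD sE modzDml subrK.
by rewrite -exprD -(expr_mod (s + m) vN) snm expr_mod.
Qed.

Lemma circ_shift_ramanujan (N q m : nat) : (0 < q)%N -> (q %| N)%N ->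
  circ_shift m%:Z (ramanujan R N q)
  = \sum_(1 <= k < q.+1 | coprime k q)
      (zeta q ^+ k) ^- m *: char_vec N (zeta q ^+ k).
Proof.
move=> q_gt0 /dvdnP[r ->]; apply/rowP => n; rewrite !mxE ramanujan_sum_nat.
rewrite summxE; apply: eq_bigr => k _; rewrite !mxE mulrC expr_subZN //.
  rewrite -exprM mulnA mulnC exprM.
  by rewrite (prim_expr_order (zeta_primitive _ q_gt0)) expr1n.
by rewrite expf_neq0 ?zeta_neq0.
Qed.

(** Since conjugation inverts [v], the inner product is the geometric sum of ratio [u / v], an
    [N]-th root of unity other than 1. *)
Lemma char_vec_orthogonal (N : nat) (u v : R[i]) :
  u ^+ N = 1 -> v ^+ N = 1 -> v^*%C = v^-1 -> u != v ->
  dotmx (char_vec N u) (char_vec N v) = 0.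
Proof.
(* For [N = 0] the sum is empty; this case is split off because [v ^+ 0 = 1] does not give
   [v != 0]. *)
move=> uN vN vJ uv; have [->|N_gt0] := posnP N.
  by rewrite ell2_dotE big_ord0.
have v0 : v != 0.
  by apply/eqP => v0; move/eqP: vN; rewrite v0 expr0n gtn_eqF // eq_sym oner_eq0.
rewrite ell2_dotE -[RHS](@sum_unity_root _ N (u / v)).
- by apply: eq_bigr => n _; rewrite !mxE rmorphXn /= vJ exprMn exprVn.
- by rewrite exprMn exprVn uN vN divr1.
- by apply: contra uv => /eqP/divr1_eq->.
Qed.

Lemma char_vec_dot_self (N : nat) (u : R[i]) :
  u != 0 -> u^*%C = u^-1 -> dotmx (char_vec N u) (char_vec N u) = N%:R.
Proof.
move=> u0 uJ; rewrite ell2_dotE -[in RHS](card_ord N) -sumr_const.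
by apply: eq_bigr => n _; rewrite !mxE rmorphXn /= uJ exprVn divff ?expf_neq0.
Qed.

(** Every root occurring in [c_q] has exact order [q], while [zeta r] has order [r]; different
    orders make the characters distinct, hence orthogonal. *)
Lemma char_vec_orthogonal_ramanujan (N q r m : nat) :
  (0 < N)%N -> (q %| N)%N -> (r %| N)%N -> q != r ->
  dotmx (char_vec N (zeta r)) (circ_shift m%:Z (ramanujan R N q)) = 0.
Proof.
move=> N_gt0 qN rN qr; have q_gt0 := dvdn_gt0 N_gt0 qN.
have r_gt0 := dvdn_gt0 N_gt0 rN.
rewrite circ_shift_ramanujan // linear_sumr /= big1 // => k kq.
have zq : q.-primitive_root (zeta q ^+ k).
  by rewrite prim_root_exp_coprime // zeta_primitive.
rewrite linearZr_LR /= char_vec_orthogonal ?mulr0 //.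
- by apply/eqP; rewrite -(prim_order_dvd (zeta_primitive _ r_gt0)).
- by apply/eqP; rewrite -(prim_order_dvd zq).
- by rewrite rmorphXn -exprVn; congr (_ ^+ _); exact: conjc_zeta.
- apply: contra qr => /eqP zrq; apply/eqP.
  by apply: prim_root_inj_order _ _ _ _ zq _; rewrite -zrq zeta_primitive.
Qed.

End RootsOfUnity.

Theorem theorem2p23 (R : realType) (N K : nat) (q : 'I_K -> nat)
    (N_gt0 : (0 < N)%N) (K_gt0 : (0 < K)%N)
    (q_inj : injective q) (q_dvd : forall i : 'I_K, (q i %| N)%N)
    (p d : nat) (p_gt0 : (0 < p)%N) (d_gt0 : (0 < d)%N)
    (N_eq : N = (p * d)%N) :
  ~ robust_one_erasure R N p d q.
Proof.
(* The channel of index 0 is erased, and the frame inequality is tested on the character of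
   [zeta (q j)]. *)
move=> /(_ (Ordinal K_gt0)); set j := Ordinal K_gt0.
move=> [A [B [A_gt0 _ /(_ (char_vec R N (zeta R (q j))))]]].
(* Each remaining channel has [i != j], so [q i != q j] by injectivity and its coefficient
   vanishes. *)
rewrite big1 => [|[k [i ij]] _]; last first.
  rewrite /ramanujan_filter_bank /= char_vec_orthogonal_ramanujan //.
    by rewrite normr0 expr0n.
  by rewrite (inj_eq q_inj).
(* The lower frame bound now reads [A * N <= 0], against [A > 0] and [N > 0]. *)
rewrite char_vec_dot_self ?zeta_neq0 ?conjc_zeta // => /andP[+ _].
apply/negP; rewrite lt_geF // mulr_gt0 ?ltr0n //.
by rewrite ltcR.
Qed.
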